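(* Let $D$ be a commutative ring and let $A$ be an associative (not necessarily commutative) unital $D$-algebra. Let $a\in A$ and let $p(x)=x-a$, a polynomial of power $1$. Let $$r(x)=r_0+r_1\circ x+\dots+r_k\circ x^k,\qquad r_i\in A^{\otimes (i+1)},\ i=0,\dots,k,$$ be a polynomial of power $k>0$ over $A$. Then there exist $s_0\in A$ and $q_i\in A_i[x]\otimes A$ for $i=0,\dots,k-1$ (so that $q_i$ is homogeneous of power $i$ in $x$) such that $$r(x)=s_0+\bigl(q_0+q_1(x)+\dots+q_{k-1}(x)\bigr)\circ p(x).$$
   Context: All tensor products are over $D$, and $A^{\otimes (n+1)}$ is the $(n+1)$-fold tensor power of $A$. A tensor $t=\sum_s t_{0,s}\otimes t_{1,s}\otimes\dots\otimes t_{n,s}\in A^{\otimes(n+1)}$ acts on the power $x^n$ by $$t\circ x^n=\sum_s t_{0,s}\,x\,t_{1,s}\,x\cdots x\,t_{n,s}$$ (for $n=0$ this is the constant $t\in A$). Such an expression is called a homogeneous polynomial of power $n$ (it is identified with the corresponding tensor $t$), and $A_n[x]$ denotes the abelian group of homogeneous polynomials of power $n$. A polynomial over $A$ of power $n$ is a finite sum $p_0+p_1\circ x+\dots+p_n\circ x^n$ with $p_i\in A^{\otimes(i+1)}$, i.e. an element of $A[x]=\bigoplus_{n\ge 0}A_n[x]$. For $q=\sum_s m_s\otimes b_s\in A_i[x]\otimes A$ with $m_s\in A_i[x]$, $b_s\in A$, write $q(x)=\sum_s m_s(x)\otimes b_s$, which for every $x\in A$ is an element of $A\otimes A$; the action of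 an element of $A\otimes A$ on $A$ is determined by $(u\otimes v)\circ y=u\,y\,v$. Thus $q(x)\circ p(x)=\sum_s m_s(x)\,p(x)\,b_s$. *)

(* Defs.v *)
From HB Require Import structures.
From mathcomp Require Import all_boot all_algebra.
From mathcomp Require Import boolp.

Set Implicit Arguments.
Unset Strict Implicit.
Unset Printing Implicit Defensive.

Import GRing.Theory.
Local Open Scope ring_scope.
Local Open Scope quotient_scope.

(* The library's algType requires 1 != 0 in the algebra, but an associative
   unital algebra over a commutative ring may be zero; a structure extending
   both pzRingType and lmodType cannot be added to the existing hierarchy, so
   algebras without this restriction are packaged in a plain record. *)
Record pzAlgType (D : comPzRingType) := PzAlgType {
  pzalg_ring : pzRingType;
  pzalg_scale : D -> pzalg_ring -> pzalg_ring;
  pzalg_scaleA d e u :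
    pzalg_scale d (pzalg_scale e u) = pzalg_scale (d * e) u;
  pzalg_scale1 : left_id 1 pzalg_scale;
  pzalg_scaleDr : right_distributive pzalg_scale +%R;
  pzalg_scaleDl u : {morph pzalg_scale^~ u : d e / d + e};
  pzalg_scaleAl d u v : pzalg_scale d (u * v) = pzalg_scale d u * v;
  pzalg_scaleAr d u v : pzalg_scale d (u * v) = u * pzalg_scale d v
}.

Definition pzalg_sort (D : comPzRingType) (A : pzAlgType D) : Type :=
  pzalg_ring A.
Coercion pzalg_sort : pzAlgType >-> Sortclass.

HB.instance Definition _ (D : comPzRingType) (A : pzAlgType D) :=
  GRing.PzRing.copy (pzalg_sort A) (pzalg_ring A).

HB.instance Definition _ (D : comPzRingType) (A : pzAlgType D) :=
  GRing.Zmodule_isLmodule.Build D (pzalg_sort A) (@pzalg_scaleA D A)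
    (@pzalg_scale1 D A) (@pzalg_scaleDr D A) (@pzalg_scaleDl D A).

Lemma pzscalerAl (D : comPzRingType) (A : pzAlgType D) (d : D) (u v : A) :
  d *: (u * v) = (d *: u) * v.
Proof. exact: pzalg_scaleAl. Qed.

Lemma pzscalerAr (D : comPzRingType) (A : pzAlgType D) (d : D) (u v : A) :
  d *: (u * v) = u * (d *: v).
Proof. exact: pzalg_scaleAr. Qed.

Definition pzalg_of_alg (D : comPzRingType) (A : algType D) : pzAlgType D :=
  @PzAlgType D A *:%R (@scalerA D A) (@scale1r D A) (@scalerDr D A)
    (fun u d e => scalerDl u d e) (@scalerAl D A) (@scalerAr D A).

Section Tensor.
Variables (D : comPzRingType) (M N : lmodType D).

(* The list [:: (m1, n1); ...; (mk, nk)] stands for the formal sum of the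
   mi (x) ni; tens_eq is the additive congruence generated by the relations
   defining the tensor product. *)
Inductive tens_eq : seq (M * N) -> seq (M * N) -> Prop :=
| tens_eq_refl s : tens_eq s s
| tens_eq_sym s t : tens_eq s t -> tens_eq t s
| tens_eq_trans s t u : tens_eq s t -> tens_eq t u -> tens_eq s u
| tens_eq_cat s s' t t' :
    tens_eq s s' -> tens_eq t t' -> tens_eq (s ++ t) (s' ++ t')
| tens_eq_catC s t : tens_eq (s ++ t) (t ++ s)
| tens_eq_0l n : tens_eq [:: (0, n)] [::]
| tens_eq_0r m : tens_eq [:: (m, 0)] [::]
| tens_eq_Dl m m' n : tens_eq [:: (m + m', n)] [:: (m, n); (m', n)]
| tens_eq_Dr m n n' : tens_eq [:: (m, n + n')] [:: (m, n); (m, n')]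
| tens_eq_Z d m n : tens_eq [:: (d *: m, n)] [:: (m, d *: n)].

Definition tens_eqb (s t : seq (M * N)) : bool := `[< tens_eq s t >].

Lemma tens_eqb_refl : reflexive tens_eqb.
Proof. by move=> s; apply/asboolP; constructor. Qed.

Lemma tens_eqb_sym : symmetric tens_eqb.
Proof. by move=> s t; apply/asboolP/asboolP; apply: tens_eq_sym. Qed.

Lemma tens_eqb_trans : transitive tens_eqb.
Proof.
by move=> t s u /asboolP st /asboolP tu; apply/asboolP; apply: tens_eq_trans tu.
Qed.

Canonical tens_equiv :=
  EquivRel tens_eqb tens_eqb_refl tens_eqb_sym tens_eqb_trans.

Definition tensor := {eq_quot tens_equiv}.

HB.instance Definition _ := Choice.on tensor.

Definition tclass (s : seq (M * N)) : tensor := \pi_tensor s.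
Definition tpure (m : M) (n : N) : tensor := tclass [:: (m, n)].

Lemma tclassP s t : tclass s = tclass t <-> tens_eq s t.
Proof.
split=> [/eqP|st]; last by apply/eqP; rewrite eqmodE; apply/asboolP.
by rewrite eqmodE => /asboolP.
Qed.

Lemma tclassK (x : tensor) : tclass (repr x) = x.
Proof. exact: reprK. Qed.

Lemma repr_tclass s : tens_eq (repr (tclass s)) s.
Proof. by apply/tclassP; rewrite tclassK. Qed.

Definition scale_sum (d : D) (s : seq (M * N)) :=
  [seq (d *: p.1, p.2) | p <- s].

Lemma tens_eq_scale d s t :
  tens_eq s t -> tens_eq (scale_sum d s) (scale_sum d t).
Proof.
elim=> {s t}.
- by move=> s; constructor.
- by move=> s t _; apply: tens_eq_sym.
- by move=> s t u _ IH1 _ IH2; apply: tens_eq_trans IH1 IH2.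
- move=> s s' t t' _ IH1 _ IH2; rewrite /scale_sum !map_cat.
  exact: tens_eq_cat.
- by move=> s t; rewrite /scale_sum !map_cat; apply: tens_eq_catC.
- by move=> n /=; rewrite scaler0; apply: tens_eq_0l.
- by move=> m /=; apply: tens_eq_0r.
- by move=> m m' n /=; rewrite scalerDr; apply: tens_eq_Dl.
- by move=> m n n' /=; apply: tens_eq_Dr.
- by move=> e m n /=; rewrite scalerA mulrC -scalerA; apply: tens_eq_Z.
Qed.

Definition tadd (x y : tensor) : tensor := tclass (repr x ++ repr y).
Definition tscale (d : D) (x : tensor) : tensor := tclass (scale_sum d (repr x)).
Definition tzero : tensor := tclass [::].
Definition topp (x : tensor) : tensor := tscale (-1) x.

Lemma tadd_class s t : tadd (tclass s) (tclass t) = tclass (s ++ t).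
Proof. by apply/tclassP; apply: tens_eq_cat; apply: repr_tclass. Qed.

Lemma tscale_class d s : tscale d (tclass s) = tclass (scale_sum d s).
Proof. by apply/tclassP; apply: tens_eq_scale; apply: repr_tclass. Qed.

Lemma taddA : associative tadd.
Proof.
move=> x y z; rewrite -[x]tclassK -[y]tclassK -[z]tclassK.
by rewrite !tadd_class; congr tclass; apply: catA.
Qed.

Lemma taddC : commutative tadd.
Proof. by move=> x y; apply/tclassP; apply: tens_eq_catC. Qed.

Lemma tadd0 : left_id tzero tadd.
Proof. by move=> x; rewrite -[x]tclassK tadd_class. Qed.

Lemma tscaleDl x d e : tscale (d + e) x = tadd (tscale d x) (tscale e x).
Proof.
rewrite -[x]tclassK !tscale_class tadd_class; apply/tclassP.
elim: (repr x) => [|[m n] s IHs] /=; first exact: tens_eq_refl.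
rewrite scalerDl -cat1s.
apply: tens_eq_trans (tens_eq_cat (tens_eq_Dl _ _ _) IHs) _.
set s1 := scale_sum d s; set s2 := scale_sum e s.
rewrite -[X in tens_eq X _]/([:: (d *: m, n)] ++ (([:: (e *: m, n)] ++ s1) ++ s2)).
rewrite -[X in tens_eq _ X]/([:: (d *: m, n)] ++ (s1 ++ ([:: (e *: m, n)] ++ s2))).
apply: tens_eq_cat (tens_eq_refl _) _; rewrite [X in tens_eq _ X]catA.
exact: tens_eq_cat (tens_eq_catC _ _) (tens_eq_refl _).
Qed.

Lemma tscaleA d e x : tscale d (tscale e x) = tscale (d * e) x.
Proof.
rewrite -[x]tclassK !tscale_class /scale_sum -map_comp; congr tclass.
by apply: eq_map => -[m n] /=; rewrite scalerA.
Qed.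

Lemma tscale1 : left_id 1 tscale.
Proof.
move=> x; rewrite -[x]tclassK tscale_class; congr tclass.
by rewrite -[RHS]map_id; apply: eq_map => -[m n] /=; rewrite scale1r.
Qed.

Lemma tscaleDr : right_distributive tscale tadd.
Proof.
move=> d x y; rewrite -[x]tclassK -[y]tclassK.
by rewrite !(tadd_class, tscale_class) /scale_sum map_cat.
Qed.

Lemma tscale0 x : tscale 0 x = tzero.
Proof.
rewrite -[x]tclassK tscale_class; apply/tclassP.
elim: (repr x) => [|[m n] s IHs] /=; first exact: tens_eq_refl.
by rewrite scale0r -cat1s; apply: (tens_eq_cat (tens_eq_0l n) IHs).
Qed.

Lemma taddN : left_inverse tzero topp tadd.
Proof. by move=> x; rewrite -{2}[x]tscale1 -tscaleDl addNr tscale0. Qed.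

HB.instance Definition _ :=
  GRing.isZmodule.Build tensor taddA taddC tadd0 taddN.

HB.instance Definition _ := GRing.Zmodule_isLmodule.Build D tensor
  tscaleA tscale1 tscaleDr (fun x d e => tscaleDl x d e).

Lemma tclassD s t : tclass (s ++ t) = tclass s + tclass t.
Proof. by rewrite -[RHS]/(tadd _ _) tadd_class. Qed.

Lemma tclassZ d s : d *: tclass s = tclass (scale_sum d s).
Proof. exact: tscale_class. Qed.

Lemma tclassE s : tclass s = \sum_(p <- s) tpure p.1 p.2.
Proof.
by elim: s => [|[m n] s IHs]; rewrite ?big_nil ?big_cons // -IHs -cat1s tclassD.
Qed.

Lemma tensorE (x : tensor) : x = \sum_(p <- repr x) tpure p.1 p.2.
Proof. by rewrite -tclassE tclassK. Qed.

Lemma tpure_linearl n : linear (tpure^~ n).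
Proof.
move=> d m m'; rewrite /tpure tclassZ -tclassD.
by apply/tclassP; apply: tens_eq_Dl.
Qed.

Lemma tpure_linearr m : linear (tpure m).
Proof.
move=> d n n'; rewrite /tpure tclassZ -tclassD.
apply/tclassP; apply: tens_eq_trans (tens_eq_Dr _ _ _) _.
rewrite -[[:: _; _]]/([:: (m, d *: n)] ++ [:: (m, n')]).
by apply: tens_eq_cat (tens_eq_refl _); apply/tens_eq_sym/tens_eq_Z.
Qed.

Section Lift.
Variable P : lmodType D.

Definition bilin (f : M -> N -> P) :=
  (forall n, linear (f^~ n)) /\ (forall m, linear (f m)).

(* For bilinear f this is the linear map with value f m n on tpure m n
   (lemmas tlift_pure and tlift_linear); it is only used for such f. *)
Definition tlift (f : M -> N -> P) (x : tensor) : P :=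
  \sum_(p <- repr x) f p.1 p.2.

Variable f : M -> N -> P.
Hypothesis f_bilin : bilin f.

Lemma bilinDl m m' n : f (m + m') n = f m n + f m' n.
Proof. by have := f_bilin.1 n 1 m m'; rewrite !scale1r. Qed.

Lemma bilinDr m n n' : f m (n + n') = f m n + f m n'.
Proof. by have := f_bilin.2 m 1 n n'; rewrite !scale1r. Qed.

Lemma bilin0l n : f 0 n = 0.
Proof. by apply: (addrI (f 0 n)); rewrite -bilinDl !addr0. Qed.

Lemma bilin0r m : f m 0 = 0.
Proof. by apply: (addrI (f m 0)); rewrite -bilinDr !addr0. Qed.

Lemma bilinZl d m n : f (d *: m) n = d *: f m n.
Proof. by have := f_bilin.1 n d m 0; rewrite /= !addr0 bilin0l addr0. Qed.

Lemma bilinZr d m n : f m (d *: n) = d *: f m n.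
Proof. by have := f_bilin.2 m d n 0; rewrite !addr0 bilin0r addr0. Qed.

Lemma tens_eq_sum s t : tens_eq s t ->
  \sum_(p <- s) f p.1 p.2 = \sum_(p <- t) f p.1 p.2.
Proof.
elim=> {s t} //.
- by move=> s t u _ -> _ ->.
- by move=> s s' t t' _ IH1 _ IH2; rewrite !big_cat /= IH1 IH2.
- by move=> s t; rewrite !big_cat /= addrC.
- by move=> n; rewrite big_seq1 big_nil bilin0l.
- by move=> m; rewrite big_seq1 big_nil bilin0r.
- by move=> m m' n; rewrite !big_cons !big_nil !addr0 /= bilinDl.
- by move=> m n n'; rewrite !big_cons !big_nil !addr0 /= bilinDr.
- by move=> d m n; rewrite !big_seq1 /= bilinZl bilinZr.
Qed.

Lemma tlift_class s : tlift f (tclass s) = \sum_(p <- s) f p.1 p.2.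
Proof. by apply: tens_eq_sum; apply: repr_tclass. Qed.

Lemma tlift_pure m n : tlift f (tpure m n) = f m n.
Proof. by rewrite tlift_class big_seq1. Qed.

Lemma tlift_linear : linear (tlift f).
Proof.
move=> d x y; rewrite -[x]tclassK -[y]tclassK.
rewrite tclassZ -tclassD !tlift_class.
rewrite big_cat big_map /= scaler_sumr; congr (_ + _).
by apply: eq_bigr => p _; rewrite bilinZl.
Qed.

End Lift.
End Tensor.

Section TensorMap.
Variables (D : comPzRingType) (M M' N N' : lmodType D).

Definition tmap (f : M -> M') (g : N -> N') : tensor M N -> tensor M' N' :=
  tlift (fun (m : M) (n : N) => tpure (f m) (g n)).

Lemma tmap_bilin (f : M -> M') (g : N -> N') :
  linear f -> linear g ->
  bilin (fun (m : M) (n : N) => tpure (f m) (g n)).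
Proof.
move=> lf lg; split=> [n d m m'|m d n n'] /=.
  by rewrite lf tpure_linearl.
by rewrite lg tpure_linearr.
Qed.

Lemma tmap_pure (f : M -> M') (g : N -> N') m n :
  linear f -> linear g ->
  tmap f g (tpure m n) = tpure (f m) (g n).
Proof. by move=> lf lg; rewrite /tmap tlift_pure //; apply: tmap_bilin. Qed.

Lemma tmap_linear (f : M -> M') (g : N -> N') :
  linear f -> linear g -> linear (tmap f g).
Proof. by move=> lf lg; apply: tlift_linear; apply: tmap_bilin. Qed.

End TensorMap.

Section Polynomials.
Variables (D : comPzRingType) (A : pzAlgType D).

(* hpoly n is A_n[x], i.e. the (n+1)-fold tensor power of A, bracketed to the
   left; in particular tensor (hpoly n) A is hpoly n.+1 by definition. *)
Fixpoint hpoly (n : nat) : lmodType D :=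
  if n is m.+1 then tensor (hpoly m) A else pzalg_sort A.

(* t o x^n, computed from (m (x) b) o x^(n+1) = (m o x^n) x b *)
Fixpoint heval (x : A) (n : nat) : hpoly n -> A :=
  match n return hpoly n -> A with
  | 0 => fun t => t
  | m.+1 => tlift (fun (u : hpoly m) (b : A) => heval x u * x * b)
  end.

(* (u (x) v) o y = u y v *)
Definition sandwich (t : tensor A A) (y : A) : A :=
  tlift (fun u v : A => u * y * v) t.

Lemma mul_linearl (b : A) : linear (fun u : A => u * b).
Proof. by move=> d u v /=; rewrite mulrDl pzscalerAl. Qed.

Lemma mul_linearr (b : A) : linear (fun v : A => b * v).
Proof. by move=> d u v /=; rewrite mulrDr pzscalerAr. Qed.

Lemma heval_bilin_linear x n : linear (@heval x n) /\
  bilin (fun (u : hpoly n) (b : A) => heval x u * x * b).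
Proof.
have bilinS m : linear (@heval x m) ->
    bilin (fun (u : hpoly m) (b : A) => heval x u * x * b).
  move=> lin; split=> [b d u v|u]; last exact: mul_linearr.
  by rewrite lin !mul_linearl.
elim: n => [|n [lin bil]]; first by split=> //; apply: bilinS.
have linS : linear (@heval x n.+1) by exact: tlift_linear.
by split=> //; apply: bilinS.
Qed.

Lemma heval_linear x n : linear (@heval x n).
Proof. by have [] := heval_bilin_linear x n. Qed.

Lemma heval0 x (t : A) : heval x (t : hpoly 0) = t.
Proof. by []. Qed.

Lemma heval_pure x n (u : hpoly n) (b : A) :
  heval x (tpure u b : hpoly n.+1) = heval x u * x * b.
Proof. by rewrite /= tlift_pure //; have [] := heval_bilin_linear x n. Qed.

Lemma sandwich_bilin y : bilin (fun u v : A => u * y * v).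
Proof.
split=> [v d u u'|u]; last exact: mul_linearr.
by rewrite !mul_linearl.
Qed.

Lemma sandwich_linear y : linear (sandwich^~ y).
Proof. by apply: tlift_linear; apply: sandwich_bilin. Qed.

Lemma sandwich_pure u v y : sandwich (tpure u v) y = u * y * v.
Proof. by rewrite /sandwich tlift_pure //; apply: sandwich_bilin. Qed.

(* A[x], the direct sum of the A_n[x] *)
Record apoly := APoly {
  acoef :> forall n, hpoly n;
  acoef_fin : exists k, forall n, (k <= n)%N -> acoef n = 0
}.

HB.instance Definition _ := gen_eqMixin apoly.
HB.instance Definition _ := gen_choiceMixin apoly.

Lemma apolyP (f g : apoly) : (forall n, f n = g n) -> f = g.
Proof.
case: f g => [f hf] [g hg] /= fg.
have fgE : f = g by apply: functional_extensionality_dep.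
by rewrite fgE in hf *; congr APoly; apply: Prop_irrelevance.
Qed.

Lemma apoly0_fin : exists k, forall n, (k <= n)%N -> (0 : hpoly n) = 0.
Proof. by exists 0. Qed.
Definition apoly0 := @APoly (fun n => 0) apoly0_fin.

Lemma apolyD_fin (f g : apoly) :
  exists k, forall n, (k <= n)%N -> f n + g n = 0.
Proof.
have [[k hk] [l hl]] := (acoef_fin f, acoef_fin g).
exists (maxn k l) => n; rewrite geq_max => /andP[kn ln].
by rewrite hk // hl // addr0.
Qed.
Definition apolyD f g := APoly (apolyD_fin f g).

Lemma apolyN_fin (f : apoly) : exists k, forall n, (k <= n)%N -> - f n = 0.
Proof. by have [k hk] := acoef_fin f; exists k => n /hk->; rewrite oppr0. Qed.
Definition apolyN f := APoly (apolyN_fin f).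

Lemma apolyZ_fin d (f : apoly) :
  exists k, forall n, (k <= n)%N -> d *: f n = 0.
Proof. by have [k hk] := acoef_fin f; exists k => n /hk->; rewrite scaler0. Qed.
Definition apolyZ d f := APoly (apolyZ_fin d f).

Lemma apolyDA : associative apolyD.
Proof. by move=> f g h; apply: apolyP => n /=; rewrite addrA. Qed.
Lemma apolyDC : commutative apolyD.
Proof. by move=> f g; apply: apolyP => n /=; rewrite addrC. Qed.
Lemma apoly0D : left_id apoly0 apolyD.
Proof. by move=> f; apply: apolyP => n /=; rewrite add0r. Qed.
Lemma apolyND : left_inverse apoly0 apolyN apolyD.
Proof. by move=> f; apply: apolyP => n /=; rewrite addNr. Qed.

HB.instance Definition _ :=
  GRing.isZmodule.Build apoly apolyDA apolyDC apoly0D apolyND.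

Lemma apolyZA d e f : apolyZ d (apolyZ e f) = apolyZ (d * e) f.
Proof. by apply: apolyP => n /=; rewrite scalerA. Qed.
Lemma apolyZ1 : left_id 1 apolyZ.
Proof. by move=> f; apply: apolyP => n /=; rewrite scale1r. Qed.
Lemma apolyZDr : right_distributive apolyZ +%R.
Proof. by move=> d f g; apply: apolyP => n /=; rewrite scalerDr. Qed.
Lemma apolyZDl f : {morph apolyZ^~ f : d e / d + e}.
Proof. by move=> d e; apply: apolyP => n /=; rewrite scalerDl. Qed.

HB.instance Definition _ := GRing.Zmodule_isLmodule.Build D apoly
  apolyZA apolyZ1 apolyZDr apolyZDl.

Lemma acoefD (f g : apoly) n : (f + g) n = f n + g n. Proof. by []. Qed.
Lemma acoefZ d (f : apoly) n : (d *: f) n = d *: f n. Proof. by []. Qed.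

(* the canonical embedding of A_n[x] in A[x] *)
Definition hembed_coef n (t : hpoly n) (m : nat) : hpoly m :=
  if eqVneq n m is EqNotNeq nm then ecast m (hpoly m) nm t else 0.

Lemma hembed_fin n (t : hpoly n) :
  exists k, forall m, (k <= m)%N -> hembed_coef t m = 0.
Proof.
exists n.+1 => m; rewrite /hembed_coef; case: eqVneq => // nm.
by rewrite {1}nm ltnn.
Qed.

Definition hembed n (t : hpoly n) : apoly := APoly (hembed_fin t).

Lemma hembed_eq n (t : hpoly n) : hembed t n = t.
Proof.
rewrite /= /hembed_coef; case: eqVneq => [e|]; last by rewrite eqxx.
by rewrite (eq_axiomK e).
Qed.

Lemma hembed_neq n (t : hpoly n) m : n != m -> hembed t m = 0.
Proof. by rewrite /= /hembed_coef; case: eqVneq. Qed.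

Lemma hembed_linear n : linear (@hembed n).
Proof.
move=> d s t; apply: apolyP => m; rewrite acoefD acoefZ.
have [<-|nm] := eqVneq n m; first by rewrite !hembed_eq.
by rewrite !hembed_neq // scaler0 addr0.
Qed.

(* hmulr t b is the tensor t with its last factor multiplied by b on the
   right, i.e. the polynomial t(x) b. *)
Definition hmulr n : hpoly n -> A -> hpoly n :=
  match n return hpoly n -> A -> hpoly n with
  | 0 => fun t b => t * b
  | m.+1 => fun t b => tmap id (fun c : A => c * b) t
  end.

Lemma id_linear (M : lmodType D) : linear (@id M). Proof. by []. Qed.

Lemma hmulr_linear n b : linear (@hmulr n ^~ b).
Proof.
case: n => [|n]; first exact: mul_linearl.
by apply: tmap_linear; [apply: id_linear | apply: mul_linearl].
Qed.

Lemma hmulr_pure n (u : hpoly n) (c b : A) :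
  hmulr (tpure u c : hpoly n.+1) b = tpure u (c * b).
Proof. by rewrite /= tmap_pure //; apply: mul_linearl. Qed.

Lemma hmulr_bilin n : bilin (@hmulr n).
Proof.
split=> [b|t]; first exact: hmulr_linear.
case: n t => [|n] t; first exact: mul_linearr.
move=> d b c; rewrite [t]tensorE.
have hsum b' (s : seq (hpoly n * A)) :
    hmulr (\sum_(p <- s) tpure p.1 p.2 : hpoly n.+1) b' =
    \sum_(p <- s) tpure p.1 (p.2 * b').
  elim: s => [|p s IHs].
    rewrite !big_nil; have := @hmulr_linear n.+1 b' (-1) 0 0.
    by rewrite scaleN1r addNr scaleN1r addNr.
  rewrite !big_cons -IHs -hmulr_pure.
  by have := @hmulr_linear n.+1 b' 1 (tpure p.1 p.2); rewrite !scale1r.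
rewrite !hsum scaler_sumr -big_split /=; apply: eq_bigr => p _.
by rewrite mul_linearr tpure_linearr.
Qed.

(* the polynomial f(x) b *)
Lemma apoly_mulr_fin (f : apoly) b :
  exists k, forall n, (k <= n)%N -> hmulr (f n) b = 0.
Proof.
have [k hk] := acoef_fin f; exists k => n /hk->.
exact: (bilin0l (hmulr_bilin n)).
Qed.
Definition apoly_mulr f b := APoly (apoly_mulr_fin f b).

(* the polynomial f(x) x b *)
Definition apoly_mulXr_coef (f : apoly) (b : A) (n : nat) : hpoly n :=
  if n is m.+1 then tpure (f m) b else 0.

Lemma apoly_mulXr_fin f b :
  exists k, forall n, (k <= n)%N -> apoly_mulXr_coef f b n = 0.
Proof.
have [k hk] := acoef_fin f; exists k.+1 => -[//|n] /hk /= ->.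
have tpure_bilin : bilin (@tpure D (hpoly n) A).
  by split; [apply: tpure_linearl | apply: tpure_linearr].
exact: (bilin0l tpure_bilin).
Qed.
Definition apoly_mulXr f b := APoly (apoly_mulXr_fin f b).

Lemma apoly_mulr_bilin : bilin apoly_mulr.
Proof.
split=> [b d f g|f d b c]; apply: apolyP => n; rewrite acoefD acoefZ /=.
  by rewrite hmulr_linear.
by rewrite (hmulr_bilin n).2.
Qed.

Lemma apoly_mulXr_bilin : bilin apoly_mulXr.
Proof.
split=> [b d f g|f d b c]; apply: apolyP => -[|n]; rewrite acoefD acoefZ /=.
- by rewrite scaler0 addr0.
- by rewrite tpure_linearl.
- by rewrite scaler0 addr0.
- by rewrite tpure_linearr.
Qed.

(* the product f(x) t(x), from f(x) (u (x) b)(x) = f(x) u(x) x b *)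
Fixpoint apoly_hmul (f : apoly) (n : nat) : hpoly n -> apoly :=
  match n return hpoly n -> apoly with
  | 0 => fun t => apoly_mulr f t
  | m.+1 => tlift (fun (u : hpoly m) (b : A) => apoly_mulXr (apoly_hmul f u) b)
  end.

Lemma apoly_hmul_linear_bilin f n : linear (@apoly_hmul f n) /\
  bilin (fun (u : hpoly n) (b : A) => apoly_mulXr (apoly_hmul f u) b).
Proof.
have bilinS m : linear (@apoly_hmul f m) ->
    bilin (fun (u : hpoly m) (b : A) => apoly_mulXr (apoly_hmul f u) b).
  move=> lin; split=> [b d u v|u]; last exact: apoly_mulXr_bilin.2.
  by rewrite /= lin apoly_mulXr_bilin.1.
elim: n => [|n [lin bil]].
  have lin0 : linear (@apoly_hmul f 0) by exact: apoly_mulr_bilin.2.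
  by split=> //; apply: bilinS.
have linS : linear (@apoly_hmul f n.+1) by exact: tlift_linear.
by split=> //; apply: bilinS.
Qed.

Lemma apoly_hmul_linear f n : linear (@apoly_hmul f n).
Proof. by have [] := apoly_hmul_linear_bilin f n. Qed.

Lemma apoly_hmul0 f (t : A) : apoly_hmul f (t : hpoly 0) = apoly_mulr f t.
Proof. by []. Qed.

Lemma apoly_hmul_pure f n (u : hpoly n) (b : A) :
  apoly_hmul f (tpure u b : hpoly n.+1) = apoly_mulXr (apoly_hmul f u) b.
Proof. by rewrite /= tlift_pure //; have [] := apoly_hmul_linear_bilin f n. Qed.

Lemma apoly_hmul_linearl n (t : hpoly n) : linear (fun f => apoly_hmul f t).
Proof.
elim: n t => [|n IHn] t d f g; first by rewrite /= apoly_mulr_bilin.1.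
rewrite [t]tensorE.
have hsum h (s : seq (hpoly n * A)) :
    apoly_hmul h (\sum_(p <- s) tpure p.1 p.2 : hpoly n.+1) =
    \sum_(p <- s) apoly_mulXr (apoly_hmul h p.1) p.2.
  elim: s => [|p s IHs].
    rewrite !big_nil; have := @apoly_hmul_linear h n.+1 (-1) 0 0.
    by rewrite scaleN1r addNr scaleN1r addNr.
  rewrite !big_cons -IHs -apoly_hmul_pure.
  by have := @apoly_hmul_linear h n.+1 1 (tpure p.1 p.2); rewrite !scale1r.
rewrite !hsum scaler_sumr -big_split /=; apply: eq_bigr => p _.
by rewrite IHn apoly_mulXr_bilin.1.
Qed.

Definition apoly_bound (f : apoly) : nat := projT1 (cid (acoef_fin f)).

Definition apoly_mul (f g : apoly) : apoly :=
  \sum_(i < apoly_bound g) apoly_hmul f (g i).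

Lemma apoly_mulE (f g : apoly) k : (forall n, (k <= n)%N -> g n = 0) ->
  apoly_mul f g = \sum_(i < k) apoly_hmul f (g i).
Proof.
have h0 n : apoly_hmul f (0 : hpoly n) = 0.
  have := @apoly_hmul_linear f n (-1) 0 0.
  by rewrite scaleN1r addNr scaleN1r addNr.
have widen l m : (forall n, (l <= n)%N -> g n = 0) -> (l <= m)%N ->
    \sum_(i < m) apoly_hmul f (g i) = \sum_(i < l) apoly_hmul f (g i).
  move=> gl lm; rewrite (big_ord_widen _ (fun i => apoly_hmul f (g i)) lm).
  rewrite [RHS]big_mkcond; apply: eq_bigr => i _.
  by case: ltnP => // /gl ->; rewrite h0.
move=> gk; rewrite /apoly_mul /apoly_bound; case: cid => l gl /=.
by case/orP: (leq_total l k) => lk; [symmetry|]; apply: widen.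
Qed.

Lemma apoly_mul_linearl g : linear (apoly_mul^~ g).
Proof.
move=> d f h; rewrite /apoly_mul scaler_sumr -big_split /=.
by apply: eq_bigr => i _; rewrite apoly_hmul_linearl.
Qed.

Lemma apoly_mul_linearr f : linear (apoly_mul f).
Proof.
move=> d g h; have [[k hk] [l hl]] := (acoef_fin g, acoef_fin h).
have gk n : (maxn k l <= n)%N -> g n = 0.
  by rewrite geq_max => /andP[/hk].
have hl' n : (maxn k l <= n)%N -> h n = 0.
  by rewrite geq_max => /andP[_ /hl].
rewrite (apoly_mulE _ gk) (apoly_mulE _ hl') (@apoly_mulE _ _ (maxn k l)).
  rewrite scaler_sumr -big_split /=; apply: eq_bigr => i _.
  by rewrite apoly_hmul_linear.
by move=> n kn; rewrite acoefD acoefZ gk // hl' // scaler0 addr0.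
Qed.

Lemma apoly_mul_hembed f n (t : hpoly n) :
  apoly_mul f (hembed t) = apoly_hmul f t.
Proof.
rewrite (@apoly_mulE _ _ n.+1) => [|m nm]; last first.
  by rewrite hembed_neq // neq_ltn nm.
rewrite big_ord_recr /= big1 ?add0r => [|i _].
  by rewrite -[hembed_coef t n]/(hembed t n) hembed_eq.
rewrite -[hembed_coef t i]/(hembed t i) hembed_neq ?gtn_eqF //.
have := @apoly_hmul_linear f i (-1) 0 0.
by rewrite scaleN1r addNr scaleN1r addNr.
Qed.

Definition apolyC (c : A) : apoly := @hembed 0 c.
Definition apolyX : apoly := @hembed 1 (tpure (1 : A) (1 : A)).

(* (u (x) b) o p = u(x) p(x) b in A[x], for u (x) b in A[x] (x) A *)
Definition apoly_act (q : tensor apoly A) (p : apoly) : apoly :=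
  tlift (fun (u : apoly) (b : A) => apoly_mul (apoly_mul u p) (apolyC b)) q.

Lemma apoly_act_bilin p :
  bilin (fun (u : apoly) (b : A) => apoly_mul (apoly_mul u p) (apolyC b)).
Proof.
split=> [b d u v|u d b c]; first by rewrite !apoly_mul_linearl.
by rewrite /apolyC hembed_linear apoly_mul_linearr.
Qed.

Lemma apoly_act_linear p : linear (fun q => apoly_act q p).
Proof. by apply: tlift_linear; apply: apoly_act_bilin. Qed.

Lemma apoly_act_pure u b p :
  apoly_act (tpure u b) p = apoly_mul (apoly_mul u p) (apolyC b).
Proof. by rewrite /apoly_act tlift_pure //; apply: apoly_act_bilin. Qed.

End Polynomials.

Arguments heval {D A} x {n} t.
Arguments hembed {D A n} t.
Arguments hpoly {D} A n.
Arguments apolyX {D A}.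
Arguments apolyC {D A} c.

(* Main.v *)
Require Import Defs.
From mathcomp Require Import all_boot all_algebra.

Set Implicit Arguments.
Unset Strict Implicit.

Import GRing.Theory.
Local Open Scope ring_scope.

(** The division is noncommutative synthetic division.  A monomial of power
    [n.+1] has the form [u(x) x b] with [u] of power [n], and
    [u(x) x b = u(x) (x - a) b + u(x) a b]: the first summand is the tensor of
    [u(x)] and [b] acting on [p = x - a], and the second one is a polynomial of
    lower power, obtained by putting [a] in place of the last [x] (lemmas
    [hembed_subst_last] and [heval_subst_last]).

    Starting from the top coefficient, one therefore defines
    [c_n = r_n + subst_last c_(n+1)], with [c_(k+1) = 0]
    (lemma [synthetic_division]).  Since [A_(i+1)[x]] is the tensor product of
    [A_i[x]] and [A], the tensors [c_(i+1)] can serve as the [q_i], and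
    [s_0 = c_0]: summing the recurrence over [n], the terms of lower power
    telescope (lemma [synthetic_division_sum]).  The telescoping depends only
    on linearity and on the splitting above, so that the same [c_n] serve for
    the identity in [A[x]] and for the identity of values at every [x]. *)

(** * Linear maps as unbundled functions *)

Section LinearProp.
Context {D : comPzRingType} {U V : lmodType D} (f : U -> V).
Hypothesis f_lin : linear f.

Lemma linear_propD u v : f (u + v) = f u + f v.
Proof. by have := f_lin 1 u v; rewrite !scale1r. Qed.

Lemma linear_prop0 : f 0 = 0.
Proof. by apply: (addrI (f 0)); rewrite -linear_propD !addr0. Qed.

Lemma linear_propB u v : f (u - v) = f u - f v.
Proof. by apply: (addIr (f v)); rewrite -linear_propD !subrK. Qed.

Lemma linear_prop_sum (I : Type) (s : seq I) (F : I -> U) :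
  f (\sum_(i <- s) F i) = \sum_(i <- s) f (F i).
Proof. exact: (big_morph f linear_propD linear_prop0). Qed.

End LinearProp.

Lemma linear_addfun (D : comPzRingType) (U V : lmodType D) (f g : U -> V) :
  linear f -> linear g -> linear (fun u => f u + g u).
Proof. by move=> lf lg d u v; rewrite lf lg scalerDr addrACA. Qed.

Lemma linear_compfun (D : comPzRingType) (U V W : lmodType D)
    (f : V -> W) (g : U -> V) :
  linear f -> linear g -> linear (fun u => f (g u)).
Proof. by move=> lf lg d u v; rewrite lg lf. Qed.

Lemma linear_tensor_ext (D : comPzRingType) (M N P : lmodType D)
    (f g : tensor M N -> P) :
  linear f -> linear g -> (forall m n, f (tpure m n) = g (tpure m n)) ->
  f =1 g.
Proof.
move=> lf lg fg t; rewrite [t]tensorE !linear_prop_sum //.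
by apply: eq_bigr => p _.
Qed.

(** * Multiplying a homogeneous polynomial on the right *)

Section RightMultiplication.
Context {D : comPzRingType} {A : pzAlgType D}.

Lemma hmulr1 n (u : hpoly A n) : hmulr u 1 = u.
Proof.
case: n u => [|n] u; first exact: mulr1.
move: u; apply: linear_tensor_ext => [||m c].
- exact: (@hmulr_linear D A n.+1).
- exact: id_linear.
- by rewrite hmulr_pure mulr1.
Qed.

Lemma hmulrA n (u : hpoly A n) (b c : A) : hmulr (hmulr u b) c = hmulr u (b * c).
Proof.
case: n u => [|n] u; first by rewrite /= mulrA.
move: u; apply: linear_tensor_ext => [||m d].
- exact: linear_compfun (@hmulr_linear D A n.+1 c) (@hmulr_linear D A n.+1 b).
- exact: (@hmulr_linear D A n.+1).
- by rewrite !hmulr_pure mulrA.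
Qed.

Lemma heval_hmulr x n (u : hpoly A n) (b : A) :
  heval x (hmulr u b) = heval x u * b.
Proof.
case: n u => [|n] u //.
move: u; apply: linear_tensor_ext => [||m d].
- exact: linear_compfun (@heval_linear D A x n.+1) (@hmulr_linear D A n.+1 b).
- exact: linear_compfun (@mul_linearl D A b) (@heval_linear D A x n.+1).
- by rewrite hmulr_pure !heval_pure mulrA.
Qed.

Lemma apoly_mulr_hembed n (u : hpoly A n) (b : A) :
  apoly_mulr (hembed u) b = hembed (hmulr u b).
Proof.
apply: apolyP => m; rewrite -[LHS]/(hmulr (hembed u m) b).
have [<-|nm] := eqVneq n m; first by rewrite !hembed_eq.
by rewrite !hembed_neq // (bilin0l (hmulr_bilin A m)).
Qed.

Lemma apoly_mulXr_hembed n (u : hpoly A n) (b : A) :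
  apoly_mulXr (hembed u) b = hembed (tpure u b : hpoly A n.+1).
Proof.
apply: apolyP => -[|m]; first by rewrite hembed_neq.
rewrite -[LHS]/(tpure (hembed u m) b).
have [<-|nm] := eqVneq n m; first by rewrite !hembed_eq.
by rewrite !hembed_neq // (linear_prop0 (tpure_linearl b)).
Qed.

End RightMultiplication.

(** * Substituting for the last indeterminate *)

Section SubstLast.
Context {D : comPzRingType} {A : pzAlgType D} (a : A).

(** On polynomials, [u(x) x b] becomes [u(x) a b]: only the last occurrence of
    [x] is replaced, which is why the result has power [n]. *)
Definition subst_last n (t : hpoly A n.+1) : hpoly A n :=
  tlift (fun (u : hpoly A n) (b : A) => hmulr u (a * b)) t.

Lemma subst_last_bilin n :
  bilin (fun (u : hpoly A n) (b : A) => hmulr u (a * b)).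
Proof.
split=> [b|u]; first exact: hmulr_linear.
by apply: linear_compfun; [apply: (hmulr_bilin A n).2 | apply: mul_linearr].
Qed.

Lemma subst_last_linear n : linear (@subst_last n).
Proof. exact: tlift_linear (subst_last_bilin n). Qed.

Lemma subst_last_pure n (u : hpoly A n) (b : A) :
  subst_last (tpure u b : hpoly A n.+1) = hmulr u (a * b).
Proof. exact: tlift_pure (subst_last_bilin n) u b. Qed.

(** This is [u(x) x b = u(x) (x - a) b + u(x) a b] in [A[x]], extended to
    tensors by linearity. *)
Lemma hembed_subst_last n (t : hpoly A n.+1) :
  hembed t = apoly_act (tmap hembed id t) (apolyX - apolyC a) +
             hembed (subst_last t).
Proof.
move: t; apply: linear_tensor_ext => [||u b].
- exact: (@hembed_linear D A n.+1).
- apply: linear_addfun.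
    apply: linear_compfun; first exact: apoly_act_linear.
    by apply: tmap_linear => //; apply: hembed_linear.
  by apply: linear_compfun; [apply: hembed_linear | apply: subst_last_linear].
rewrite tmap_pure //; last exact: hembed_linear.
rewrite apoly_act_pure subst_last_pure.
rewrite (linear_propB (apoly_mul_linearr _)) (linear_propB (apoly_mul_linearl _)).
rewrite /apolyX /apolyC !apoly_mul_hembed apoly_hmul_pure !apoly_hmul0.
rewrite !apoly_mulr_hembed hmulr1 apoly_mulXr_hembed apoly_mulr_hembed.
by rewrite hmulr_pure mul1r hmulrA subrK.
Qed.

(** The same splitting on values.  For a pure tensor it is an identity between
    products in [A], so that it can be had directly, without showing first that
    evaluation is compatible with the product of [A[x]]. *)
Lemma heval_subst_last x n (t : hpoly A n.+1) :
  heval x t = sandwich (tmap (heval x) id t) (x - a) +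
              heval x (subst_last t).
Proof.
move: t; apply: linear_tensor_ext => [||u b].
- exact: (@heval_linear D A x n.+1).
- apply: linear_addfun.
    apply: linear_compfun; first exact: sandwich_linear.
    by apply: tmap_linear => //; apply: heval_linear.
  by apply: linear_compfun; [apply: heval_linear | apply: subst_last_linear].
rewrite tmap_pure //; last exact: heval_linear.
rewrite sandwich_pure subst_last_pure heval_pure heval_hmulr.
by rewrite mulrBr mulrBl mulrA subrK.
Qed.

End SubstLast.

(** * Synthetic division *)

Section SyntheticDivision.
Context {D : comPzRingType} {A : pzAlgType D} (a : A).

Lemma synthetic_division k (r : forall n, hpoly A n) :
  exists c : forall n, hpoly A n, c k.+1 = 0 /\
    forall n, (n <= k)%N -> c n = r n + subst_last a (c n.+1).
Proof.
(* The recursion descends in the power, so it is driven by a counter, which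
   will be the number of coefficients of power between [n] and [k]. *)
pose fix h (j n : nat) {struct j} : hpoly A n :=
  if j is i.+1 then r n + subst_last a (h i n.+1) else 0.
exists (fun n => h (k.+1 - n)%N n); split=> [|n nk]; first by rewrite subnn.
by rewrite subSS subSn.
Qed.

(** [E] stands for a way to read homogeneous polynomials in a common module,
    and [H n t] for what [t o x^(n+1)] contributes as a multiple of [x - a]. *)
Lemma synthetic_division_sum k (r c : forall n, hpoly A n) (V : lmodType D)
    (E : forall n, hpoly A n -> V) (H : forall n, hpoly A n.+1 -> V) :
  c k.+1 = 0 ->
  (forall n, (n <= k)%N -> c n = r n + subst_last a (c n.+1)) ->
  (forall n, linear (E n)) ->
  (forall n t, E n.+1 t = H n t + E n (subst_last a t)) ->
  \sum_(i < k.+1) E i (r i) = E 0 (c 0) + \sum_(i < k) H i (c i.+1).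
Proof.
move=> ck cE linE EH.
have rE (i : 'I_k.+1) :
    E i (r i) = E i (c i) - E i (subst_last a (c i.+1)).
  have ik : (i <= k)%N by rewrite -ltnS.
  by rewrite [in RHS](cE i ik) (linear_propD (linE i) (r i)) addrK.
rewrite (eq_bigr _ (fun i _ => rE i)) sumrB big_ord_recl big_ord_recr /=.
rewrite ck (linear_prop0 (subst_last_linear a (n:=k))) (linear_prop0 (linE k)) addr0.
rewrite -addrA -sumrB; congr (_ + _); apply: eq_bigr => i _.
by rewrite EH addrK.
Qed.

End SyntheticDivision.

(** The descending recursion passes from power [n] to power [n.+1] in a
    dependent family, which is simplest when the index is a plain number. *)
Lemma extend_ord_family (n : nat) (T : nat -> Type) (x0 : forall i, T i)
    (r : forall i : 'I_n, T i) :
  exists r' : forall i, T i, forall i : 'I_n, r' i = r i.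
Proof.
exists (fun m => if ltnP m n is LtnNotGeq mn then r (Ordinal mn) else x0 m).
move=> i; case: ltnP => [mn|]; last by rewrite leqNgt ltn_ord.
by case: i mn => m mn0 mn; rewrite (bool_irrelevance mn mn0).
Qed.

Theorem theorem8p5 (D : comPzRingType) (A : pzAlgType D) (a : A) (k : nat)
    (k_gt0 : (0 < k)%N) (r : forall i : 'I_k.+1, hpoly A i) :
  exists (s0 : A) (q : forall i : 'I_k, tensor (hpoly A i) A),
    (* the identity in A[x], with p = x - a in A[x] *)
    \sum_(i < k.+1) hembed (r i) =
      apolyC s0 + apoly_act (\sum_(i < k) tmap hembed id (q i)) (apolyX - apolyC a)
    (* the identity of values at every x in A *)
    /\ forall x : A,
    \sum_(i < k.+1) heval x (r i) =
      s0 + sandwich (\sum_(i < k) tmap (heval x) id (q i)) (x - a).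
Proof.
have [r' r'E] := @extend_ord_family _ (hpoly A) (fun=> 0) r.
have [c [ck cE]] := synthetic_division a k r'.
exists (c 0), (fun i => c i.+1); split=> [|x].
  rewrite (linear_prop_sum (apoly_act_linear _)).
  under eq_bigr do rewrite -r'E.
  exact: (synthetic_division_sum ck cE (@hembed_linear D A)
            (@hembed_subst_last D A a)).
rewrite (linear_prop_sum (sandwich_linear _)).
under eq_bigr do rewrite -r'E.
exact: (synthetic_division_sum ck cE (@heval_linear D A x)
          (@heval_subst_last D A a x)).
Qed.
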